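(* Let $n \leq m$ be positive integers and let $r$ be an integer with $1 \leq r \leq \frac{n}{2}$. Then the Cartesian product $K_n \times K_m$ of complete graphs is $r$-EKR.
   Context: For a positive integer $n$, $K_n$ is the complete graph on the vertex set $[n] = \{1,\dots,n\}$. The Cartesian product $G \times H$ of graphs $G$ and $H$ is the graph with vertex set $V(G) \times V(H)$ and edge set $\{ (g_1,h_1)(g_2,h_2) : (g_1 = g_2 \text{ and } h_1h_2 \in E(H)) \text{ or } (h_1 = h_2 \text{ and } g_1g_2 \in E(G)) \}$. (So in $K_n \times K_m$ two distinct vertices are adjacent exactly when they share a first coordinate or share a second coordinate.) For a graph $G$ and a positive integer $r$, $\mathcal{I}^{(r)}(G)$ denotes the collection of all independent subsets of $V(G)$ of size $r$, and for $v \in V(G)$, $\mathcal{I}^{(r)}_v(G)$ denotes the star centered at $v$, i.e. the collection of all members of $\mathcal{I}^{(r)}(G)$ that contain $v$. A family $\mathcal{F}$ of sets is intersecting if $F \cap F' \neq \emptyset$ for any $F, F' \in \mathcal{F}$. A graph $G$ is $r$-EKR if there exists a vertex $v \in V(G)$ such that for every intersecting family $\mathcal{F} \subseteq \mathcal{I}^{(r)}(G)$, $|\mathcal{F}| \leq |\mathcal{I}^{(r)}_v(G)|$. *)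

(* Defs.v *)
From mathcomp Require Import all_boot.

Set Implicit Arguments.
Unset Strict Implicit.
Unset Printing Implicit Defensive.

Record sgraph := SGraph {
  vertex :> finType;
  adj : rel vertex;
  adj_sym : symmetric adj;
  adj_irrefl : irreflexive adj
}.

Section CompleteGraph.
Variable n : nat.

Definition complete_adj : rel 'I_n := fun i j => i != j.

Fact complete_adj_sym : symmetric complete_adj.
Proof. by move=> i j; rewrite /complete_adj eq_sym. Qed.

Fact complete_adj_irrefl : irreflexive complete_adj.
Proof. by move=> i; rewrite /complete_adj eqxx. Qed.

(* The vertices 1, ..., n are represented by 0, ..., n - 1. *)
Definition complete_graph := SGraph complete_adj_sym complete_adj_irrefl.
End CompleteGraph.

Section CartesianProduct.
Variables G H : sgraph.

Definition cart_adj : rel (G * H)%type := fun u v =>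
  (u.1 == v.1) && adj u.2 v.2 || (u.2 == v.2) && adj u.1 v.1.

Fact cart_adj_sym : symmetric cart_adj.
Proof.
move=> u v; rewrite /cart_adj (eq_sym u.1) (eq_sym u.2).
by rewrite (adj_sym u.1) (adj_sym u.2).
Qed.

Fact cart_adj_irrefl : irreflexive cart_adj.
Proof. by move=> u; rewrite /cart_adj !adj_irrefl !andbF. Qed.

Definition cart_prod := SGraph cart_adj_sym cart_adj_irrefl.
End CartesianProduct.

Definition independent (G : sgraph) (S : {set G}) : bool :=
  [forall x in S, forall y in S, ~~ adj x y].

Definition indep_sets (r : nat) (G : sgraph) : {set {set G}} :=
  [set S : {set G} | independent S & #|S| == r].

Definition indep_star (r : nat) (G : sgraph) (v : G) : {set {set G}} :=
  [set S in indep_sets r G | v \in S].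

Definition intersecting (T : finType) (F : {set {set T}}) : Prop :=
  forall A B : {set T}, A \in F -> B \in F -> A :&: B != set0.

Definition EKR (r : nat) (G : sgraph) : Prop :=
  exists v : G, forall F : {set {set G}},
    F \subset indep_sets r G -> intersecting F -> #|F| <= #|indep_star r v|.

(* Main.v *)
Require Import Defs.
From mathcomp Require Import all_boot.
From mathcomp Require Import all_fingroup all_solvable.
From mathcomp Require Import zify.

Set Implicit Arguments.
Unset Strict Implicit.
Unset Printing Implicit Defensive.

(** This is Katona's circle argument, run on a family of cycles adapted to the
    two coordinates.

    An independent r-set of the n by m grid is a placement of r non-attacking
    rooks, or a partial matching of size r between rows and columns. Fix such
    sets B(i, k), the bands: the rooks of B(i, k) stand in the r cyclically
    consecutive rows i, ..., i + r - 1 (mod n), and the rook in row j stands in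
    column j + k (mod m). They are independent because n <= m. Two bands with
    different shifts k are disjoint, since in a given row they use different
    columns. So an intersecting family contains bands of one shift only, and
    their row arcs pairwise meet. As 2r <= n, at most r arcs of length r on a
    circle of length n can pairwise meet [card_meeting_arcs]. Hence an
    intersecting family contains at most r of the n * m bands, and the same
    holds after permuting rows and columns arbitrarily.

    Permutations of rows and columns act transitively on the independent r-sets
    [trans_indep_grid], so averaging over them [transitive_averaging] turns
    this into a density bound: an intersecting family F of independent r-sets
    satisfies #|F| * (n * m) <= r * #|indep_sets r|. On the other hand the stars
    of the n * m vertices cover each independent r-set exactly r times, so the
    largest star has density at least r / (n * m) [EKR_density]. *)

(** * Pairwise meeting arcs on a circle *)

Lemma modn_wrap n a : a < n + n -> a %% n = if a < n then a else a - n.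
Proof.
move=> lt_a; case: ltnP => [/modn_small //|le_na].
by rewrite -{1}(subnK le_na) modnDr modn_small; lia.
Qed.

(** Katona's bound for arcs of length r on a circle of length n. Fix one arc of
    the family. Any other arc meeting it starts at a distance t from it, with
    0 < t < r, clockwise or counterclockwise. Pair the arc starting at t with
    the one starting at t - r: these are adjacent, hence disjoint as 2r <= n, so
    each of the r - 1 pairs contributes at most one arc. *)
Lemma card_meeting_arcs (n r : nat) (S : {set 'I_n}) : r * 2 <= n ->
  {in S &, forall i j : 'I_n, exists t u,
     [/\ t < r, u < r & i + t = j + u %[mod n]]} ->
  #|S| <= r.
Proof.
move=> le_2r_n meetS.
have [->|[i0 Si0]] := set_0Vmem S; first by rewrite cards0.
have r_gt0 : 0 < r by have [t [u [? _ _]]] := meetS _ _ Si0 Si0; lia.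
(* [d s] is the clockwise distance from i0 to s; [f s] identifies the starting
   points t and t - r (that is, t + n - r) for each 0 < t < r. *)
pose d (s : 'I_n) := if i0 <= s then s - i0 else s + n - i0.
pose f s := if d s < r then d s else d s - (n - r).
(* Meeting arcs start at most r - 1 steps apart, one way round or the other. *)
have arc s1 s2 : s1 \in S -> s2 \in S ->
    d s1 < d s2 -> d s2 - d s1 < r \/ n - (d s2 - d s1) < r.
  move=> S1 S2; have [t [u [ltt ltu]]] := meetS _ _ S1 S2.
  have := ltn_ord s1; have := ltn_ord s2; have := ltn_ord i0.
  move=> lt_i0 lt_s2 lt_s1; rewrite /d !modn_wrap; [|lia..].
  by do 4 (case: ifP => ?); lia.
have d_lt s : d s < n.
  by have := ltn_ord s; have := ltn_ord i0; rewrite /d; case: ifP; lia.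
have near s : s \in S -> d s < r \/ n - d s < r.
  have d0 : d i0 = 0 by rewrite /d; case: ifP; lia.
  by move=> Ss; have := arc _ _ Si0 Ss; rewrite d0; lia.
have f_lt s : s \in S -> f s < r.
  by move/near; rewrite /f; have := d_lt s; case: ifP; lia.
have d_inj s1 s2 : d s1 = d s2 -> s1 = s2.
  move=> eqd; apply: val_inj => /=; move: eqd.
  have := ltn_ord s1; have := ltn_ord s2; have := ltn_ord i0.
  by rewrite /d; do 2 case: ifP; lia.
have f_inj : {in S &, injective f}.
  move=> s1 s2 S1 S2 eqf; apply: d_inj; move: eqf.
  have := arc _ _ S1 S2; have := arc _ _ S2 S1.
  have := near _ S1; have := near _ S2.
  have := d_lt s1; have := d_lt s2.
  by rewrite /f; do 2 case: ifP; lia.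
pose h s : 'I_r := insubd (Ordinal r_gt0) (f s).
have h_inj : {in S &, injective h}.
  move=> s1 s2 S1 S2 /(congr1 val); rewrite !val_insubd !f_lt //.
  exact: f_inj.
by rewrite -(card_in_imset h_inj) (leq_trans (max_card _)) // card_ord.
Qed.

(** * Averaging over a transitive action *)

(** The elements moving x to y form a coset of the stabiliser of x, so each
    point of S is reached from x equally often. *)
Lemma card_amove (aT : finGroupType) (rT : finType) (to : {action aT &-> rT})
    (G : {group aT}) (S : {set rT}) (x y : rT) :
  [transitive G, on S | to] -> x \in S -> y \in S ->
  #|S| * #|amove to G x y| = #|G|.
Proof.
move=> trG Sx Sy; have orbS := atransP trG x Sx.
move: Sy; rewrite -orbS => /orbitP[a Ga <-].
by rewrite amove_act ?subsetT // card_rcoset card_orbit_in_stab ?subsetT.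
Qed.

(** If every translate of the configuration B hits F at most k times, count the
    pairs (g, i) such that the translate of B i by g lies in F. Each B i is
    uniformly spread over S as g runs through G, so it lands in F exactly
    #|F| * #|G| / #|S| times; summing over i gives the bound. *)
Lemma transitive_averaging (aT : finGroupType) (rT I : finType)
    (to : {action aT &-> rT}) (G : {group aT}) (S F : {set rT})
    (B : I -> rT) (k : nat) :
  [transitive G, on S | to] -> F \subset S -> (forall i, B i \in S) ->
  (forall g, g \in G -> #|[set i | to (B i) g \in F]| <= k) ->
  #|F| * #|I| <= k * #|S|.
Proof.
move=> trG sFS SB leFk.
have countG i : #|S| * \sum_(g in G) (to (B i) g \in F) = #|F| * #|G|.
  transitivity (#|S| * \sum_(y in F) #|amove to G (B i) y|).
    congr (_ * _); rewrite -big_mkcondr sum1_card.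
    rewrite -sum1_card (partition_big (to (B i)) (mem F)) => [|g /andP[]//].
    apply: eq_bigr => y Fy; rewrite sum1_card; apply: eq_card => g.
    transitivity [&& g \in G, to (B i) g \in F & to (B i) g == y].
      by rewrite andbA.
    rewrite inE; case: (to (B i) g =P y) => [->|_]; last by rewrite !andbF.
    by rewrite [y \in F]Fy.
  rewrite big_distrr -sum_nat_const; apply: eq_bigr => y Fy.
  by rewrite /= (card_amove trG) // (subsetP sFS).
have leG : \sum_(i : I) \sum_(g in G) (to (B i) g \in F) <= k * #|G|.
  rewrite exchange_big mulnC -sum_nat_const; apply: leq_sum => g Gg.
  by rewrite (leq_trans _ (leFk g Gg)) // -big_mkcond sum1_card cardsE.
have sumG : #|F| * #|I| * #|G| =
    #|S| * \sum_(i : I) \sum_(g in G) (to (B i) g \in F).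
  rewrite big_distrr /= (eq_bigr _ (fun i _ => countG i)) sum_nat_const.
  by rewrite mulnCA mulnA.
rewrite -(leq_pmul2r (cardG_gt0 G)) sumG mulnAC mulnC.
by rewrite leq_mul2r leG orbT.
Qed.

(** * Stars *)

Lemma sum_card_star (r : nat) (G : sgraph) :
  \sum_(v : G) #|indep_star r v| = r * #|indep_sets r G|.
Proof.
rewrite mulnC -sum_nat_const.
under eq_bigr => v _ do rewrite -sum1_card big_set big_mkcondr.
rewrite exchange_big; apply: eq_bigr => A; rewrite inE => /andP[_ /eqP <-].
by rewrite -big_mkcond sum1_card.
Qed.

(** By [sum_card_star] the average size of a star is r * #|indep_sets r G| / #|G|;
    a star of maximal size is at least as large as this average. *)
Lemma EKR_density (r : nat) (G : sgraph) :
  0 < #|G| ->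
  (forall F : {set {set G}}, F \subset indep_sets r G -> intersecting F ->
     #|F| * #|G| <= r * #|indep_sets r G|) ->
  EKR r G.
Proof.
move=> G_gt0 leF; have /card_gt0P[v0 _] := G_gt0.
case: (@arg_maxnP _ v0 xpredT (fun v => #|indep_star r v|)) => // v _ max_v.
exists v => F sF intF; rewrite -(leq_pmul2r G_gt0) (leq_trans (leF F sF intF)) //.
rewrite -sum_card_star mulnC -sum_nat_const.
by apply: leq_sum => u _; apply: max_v.
Qed.

(** * Cyclic shifts and permutations *)

(** The symmetric group on T is #|T|-transitive, hence #|I|-transitive as well.
    The families f and g are compared through their listings [codom f] and
    [codom g], which are duplicate-free #|I|-tuples. *)
Lemma perm_extending (T : finType) (I : finType) (f g : I -> T) :
  injective f -> injective g -> exists s : {perm T}, forall i, s (f i) = g i.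
Proof.
move=> f_inj g_inj.
have le_I : #|I| <= #|T| by rewrite -(card_codom f_inj) max_card.
have dtuple_codom (h : I -> T) : injective h ->
    [tuple of codom h] \in #|I|.-dtuple([set: T]).
  move=> h_inj; rewrite inE map_inj_uniq // enum_uniq.
  by apply/subsetP => x; rewrite !inE.
have trT := ntransitive_weak le_I (Sym_trans T).
have [s _ /(congr1 val) /= def_g] := atransP2 trT
  (dtuple_codom f f_inj) (dtuple_codom g g_inj).
exists s => i; have lt_i : enum_rank i < size (codom f) by rewrite size_codom.
have := congr1 (fun l => nth (g i) l (enum_rank i)) def_g.
by rewrite (nth_map (f i)) // !nth_codom enum_rankK.
Qed.

Definition ord_shift n (i : 'I_n) (t : nat) : 'I_n :=
  Ordinal (ltn_pmod (i + t) (leq_ltn_trans (leq0n i) (ltn_ord i))).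

Lemma ord_shift_inj n (i : 'I_n) (t u : nat) :
  ord_shift i t = ord_shift i u -> t < n -> u < n -> t = u.
Proof.
by move=> [/eqP]; rewrite eqn_modDl => /eqP eqtu /modn_small<- /modn_small<-.
Qed.

(** * Independent sets of the grid *)

Section Grid.
Variables n m : nat.

Definition grid := cart_prod (complete_graph n) (complete_graph m).

Definition permute (x : 'I_n * 'I_m) (g : {perm 'I_n} * {perm 'I_m}) :=
  (g.1 x.1, g.2 x.2).

Fact permute_is_action : is_action setT permute.
Proof.
apply: is_total_action => [[i j]|[i j] g h]; rewrite /permute /=.
  by rewrite !perm1.
by rewrite !permM.
Qed.

Definition grid_action := Action permute_is_action.

Lemma independent_gridP (A : {set grid}) :
  reflect ({in A &, injective fst} /\ {in A &, injective snd}) (independent A).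
Proof.
apply: (iffP forall_inP) => [indA|[inj1 inj2] x Ax].
  have nadj x y : x \in A -> y \in A -> ~~ adj x y.
    by move=> Ax; apply/forall_inP: y; apply: indA.
  split=> [[i j] [i' j'] Ax Ay|[i j] [i' j'] Ax Ay] /= eqij; subst;
    have := nadj _ _ Ax Ay; rewrite /= /cart_adj /= /complete_adj !eqxx /=.
    by rewrite andbF orbF negbK => /eqP->.
  by rewrite andbF negbK => /eqP->.
apply/forall_inP => y Ay; rewrite /= /cart_adj /= /complete_adj.
apply/norP; split; apply/negP => /andP[/eqP eqxy].
  by rewrite (inj1 x y) ?eqxx.
by rewrite (inj2 x y) ?eqxx.
Qed.

Lemma indep_grid_stable r (A : {set grid}) g :
  A \in indep_sets r grid -> grid_action^*%act A g \in indep_sets r grid.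
Proof.
rewrite !inE card_setact => /andP[/independent_gridP[inj1 inj2] ->].
rewrite andbT; apply/independent_gridP; rewrite /= setactE.
split=> _ _ /imsetP[x Ax ->] /imsetP[y Ay ->] /= /perm_inj eqxy.
  by rewrite (inj1 x y).
by rewrite (inj2 x y).
Qed.

(** Listing A and A' in some order gives a matching of their rows and a matching
    of their columns. Both are injective by [independent_gridP], so they extend
    to a permutation of all rows and one of all columns. *)
Lemma indep_grid_movable r (A A' : {set grid}) :
  A \in indep_sets r grid -> A' \in indep_sets r grid ->
  exists g, grid_action^*%act A g = A'.
Proof.
rewrite !inE => /andP[/independent_gridP[inj1 inj2] /eqP cardA].
move=> /andP[/independent_gridP[inj1' inj2'] /eqP cardA'].
have eqAA' : #|A| = #|A'| by rewrite cardA.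
pose a (i : 'I_#|A|) := enum_val i : grid.
pose a' (i : 'I_#|A|) := enum_val (cast_ord eqAA' i) : grid.
have Aa i : a i \in A by apply: enum_valP.
have Aa' i : a' i \in A' by apply: enum_valP.
have a_inj : injective a by apply: enum_val_inj.
have a'_inj : injective a' by move=> i j /enum_val_inj/cast_ord_inj.
have [s def_s] := @perm_extending _ _ (fun i => (a i).1) (fun i => (a' i).1)
  (fun i j eqij => a_inj _ _ (inj1 _ _ (Aa i) (Aa j) eqij))
  (fun i j eqij => a'_inj _ _ (inj1' _ _ (Aa' i) (Aa' j) eqij)).
have [t def_t] := @perm_extending _ _ (fun i => (a i).2) (fun i => (a' i).2)
  (fun i j eqij => a_inj _ _ (inj2 _ _ (Aa i) (Aa j) eqij))
  (fun i j eqij => a'_inj _ _ (inj2' _ _ (Aa' i) (Aa' j) eqij)).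
exists (s, t); apply/eqP.
rewrite eqEcard card_setact eqAA' leqnn andbT /= setactE.
apply/subsetP => _ /imsetP[x Ax ->].
rewrite -(enum_rankK_in Ax Ax) -/(a _) /= /permute /= def_s def_t.
by rewrite -surjective_pairing.
Qed.

(** An empty set is not an orbit, so transitivity needs some member A. *)
Lemma trans_indep_grid r (A : {set grid}) :
  A \in indep_sets r grid ->
  [transitive [set: {perm 'I_n} * {perm 'I_m}],
     on indep_sets r grid | grid_action^*].
Proof.
move=> indA; apply/imsetP; exists A => //; apply/setP => A'.
apply/idP/orbitP => [indA'|[g _ <-]]; last exact: indep_grid_stable.
by have [g <-] := indep_grid_movable indA indA'; exists g.
Qed.

(** The parameter p = (i, k) consists of the first row i of the band and its
    column shift k: the point in row j is in column k + j modulo m. *)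
Definition band_point (p : 'I_n * 'I_m) (t : nat) : grid :=
  (ord_shift p.1 t, ord_shift p.2 (ord_shift p.1 t)).

Definition band r (p : 'I_n * 'I_m) : {set grid} :=
  [set band_point p t | t : 'I_r].

(** The shift by k modulo m is injective on the rows because n <= m. *)
Lemma indep_band r p : n <= m -> r <= n -> band r p \in indep_sets r grid.
Proof.
move=> le_nm le_rn.
have row_inj : injective (fun t : 'I_r => ord_shift p.1 t).
  by move=> t u /ord_shift_inj eqtu; apply: val_inj; apply: eqtu;
     apply: leq_trans le_rn.
rewrite inE card_imset ?card_ord ?eqxx ?andbT; last first.
  by move=> t u [/eqP eqtu _]; apply: row_inj; apply: val_inj; apply/eqP.
apply/independent_gridP; split=> _ _ /imsetP[t _ ->] /imsetP[u _ ->] /=.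
  by move/row_inj->.
move=> /ord_shift_inj eqtu; rewrite (_ : t = u) //; apply: row_inj.
by apply: val_inj; apply: eqtu; apply: leq_trans le_nm;
  apply: ltn_ord (ord_shift _ _).
Qed.

(** A common point determines the column shift: it is the column minus the
    row, modulo m. *)
Lemma band_meet r p q : band r p :&: band r q != set0 ->
  p.2 = q.2 /\ exists t u, [/\ t < r, u < r & p.1 + t = q.1 + u %[mod n]].
Proof.
case/set0Pn => x /setIP[/imsetP[t _ ->] /imsetP[u _ [eq1 eq2]]].
split; last by exists t, u.
apply/val_inj/eqP; move/eqP: eq2; rewrite /= eq1 eqn_modDr.
by rewrite !modn_small.
Qed.
End Grid.

Theorem theorem3 (n m r : nat) (n_gt0 : 0 < n) (n_le_m : n <= m)
    (r_ge1 : 1 <= r) (r_le_half : r * 2 <= n) :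
  EKR r (cart_prod (complete_graph n) (complete_graph m)).
Proof.
have le_rn : r <= n by lia.
have card_grid : #|grid n m| = n * m by rewrite card_prod !card_ord.
have n_m_gt0 : 0 < n * m by rewrite muln_gt0 n_gt0 (leq_trans n_gt0).
apply: EKR_density; first by rewrite card_grid.
move=> F sF intF; rewrite -/(grid n m).
have /card_gt0P[p0 _] : 0 < #|grid n m| by rewrite card_grid.
have trG := trans_indep_grid (indep_band p0 n_le_m le_rn).
apply: (transitive_averaging trG sF (B := band r)) => [p|g _].
  exact: indep_band.
set P := [set p | _].
have meetP p q : p \in P -> q \in P -> band r p :&: band r q != set0.
  rewrite !inE => Fp Fq; have := intF _ _ Fp Fq.
  apply: contraNneq => eq0; rewrite /= !setactE -imsetI ?eq0 ?imset0 //.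
  by move=> x y _ _; apply: (act_inj (grid_action n m)).
(* All the bands hit share their column shift, so they are counted by their
   starting rows. *)
have row_inj : {in P &, injective fst}.
  move=> p q Pp Pq eq1; have [eq2 _] := band_meet (meetP _ _ Pp Pq).
  by case: p q eq1 eq2 {Pp Pq} => [? ?] [? ?] /= -> ->.
rewrite -(card_in_imset row_inj); apply: card_meeting_arcs => //.
move=> _ _ /imsetP[p Pp ->] /imsetP[q Pq ->].
by have [_] := band_meet (meetP _ _ Pp Pq).
Qed.
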